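(* Let $\lambda_1,\dots,\lambda_N$ be distinct points of the open unit disk $\mathbb{D}$ and let $w_1,\dots,w_N\in\mathbb{C}$. Suppose the $N\times N$ Hermitian matrix $$\Gamma=\left(\frac{1-w_i\overline{w_j}}{1-\lambda_i\overline{\lambda_j}}\right)_{i,j=1}^N$$ has $\pi$ positive eigenvalues, $\nu$ negative eigenvalues, and $\zeta$ zero eigenvalues (counted with multiplicity, so $\pi+\nu+\zeta=N$). Then there exists a rational function $\phi$ of one complex variable that is unimodular on the unit circle $\mathbb{T}$, such that $\phi(\lambda_i)=w_i$ for every $1\le i\le N$, and such that $\phi$ has at most $N-\pi$ poles and at most $N-\nu$ zeroes in $\mathbb{D}$.
   Context: $\mathbb{D}=\{z\in\mathbb{C}:|z|<1\}$ and $\mathbb{T}=\{z\in\mathbb{C}:|z|=1\}$. A rational function is unimodular on $\mathbb{T}$ if it has modulus one at every point of $\mathbb{T}$. The condition $\phi(\lambda_i)=w_i$ is meant in the strict sense: $\lim_{\lambda\to\lambda_i}\phi(\lambda)=w_i$ (in particular $\lambda_i$ is not a pole of $\phi$). Zeroes and poles are counted with multiplicity, as for a rational function in lowest terms. *)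

(* Defs.v *)
From HB Require Import structures.
From mathcomp Require Import all_boot all_order all_algebra.
From mathcomp Require Import complex.
From mathcomp Require Import classical_sets filter reals topology normedtype.

Set Implicit Arguments.
Unset Strict Implicit.
Unset Printing Implicit Defensive.

Import Order.TTheory GRing.Theory Num.Theory.
Import numFieldNormedType.Exports.
Local Open Scope classical_set_scope.
Local Open Scope quotient_scope.
Local Open Scope ring_scope.

(* The root sequence is meaningful only for p != 0: for p = 0,
   [closed_field_poly_normal] gives no information. *)
Definition poly_roots (F : closedFieldType) (p : {poly F}) : seq F :=
  sval (closed_field_poly_normal p).

Lemma poly_rootsE (F : closedFieldType) (p : {poly F}) :
  p = lead_coef p *: \prod_(z <- poly_roots p) ('X - z%:P).
Proof. exact: svalP (closed_field_poly_normal p). Qed.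

Definition eigenvalues (F : closedFieldType) (n : nat) (A : 'M[F]_n) : seq F :=
  poly_roots (char_poly A).

Lemma eigenvaluesE (F : closedFieldType) (n : nat) (A : 'M[F]_n) :
  char_poly A = \prod_(a <- eigenvalues A) ('X - a%:P).
Proof.
by rewrite {1}(poly_rootsE (char_poly A)) (monicP (char_poly_monic A)) scale1r.
Qed.

Lemma size_eigenvalues (F : closedFieldType) (n : nat) (A : 'M[F]_n) :
  size (eigenvalues A) = n.
Proof.
by have := size_char_poly A; rewrite eigenvaluesE size_prod_XsubC => -[].
Qed.

(* Rational functions are elements of {fraction {poly F}}. The two polynomials
   below represent such a function in lowest terms; they are determined up to
   a common nonzero constant factor, on which nothing below depends. *)
Definition ratnum (F : fieldType) (phi : {fraction {poly F}}) : {poly F} :=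
  \n_(repr phi) %/ gcdp \n_(repr phi) \d_(repr phi).

Definition ratden (F : fieldType) (phi : {fraction {poly F}}) : {poly F} :=
  \d_(repr phi) %/ gcdp \n_(repr phi) \d_(repr phi).

Lemma ratden_neq0 (F : fieldType) (phi : {fraction {poly F}}) :
  ratden phi != 0.
Proof.
have d0 : \d_(repr phi) != 0 := denom_ratioP (repr phi).
by rewrite dvdp_div_eq0 ?dvdp_gcdr.
Qed.

Lemma coprimep_ratnum_ratden (F : fieldType) (phi : {fraction {poly F}}) :
  coprimep (ratnum phi) (ratden phi).
Proof.
by apply: coprimep_div_gcd; rewrite (denom_ratioP (repr phi)) orbT.
Qed.

Lemma ratnum_div_ratden (F : fieldType) (phi : {fraction {poly F}}) :
  phi = tofrac (ratnum phi) / tofrac (ratden phi).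
Proof.
set n := \n_(repr phi); set d := \d_(repr phi).
have d0 : d != 0 := denom_ratioP (repr phi).
have g0 : gcdp n d != 0 by rewrite gcdp_eq0 negb_and d0 orbT.
have phiE : phi * tofrac d = tofrac n.
  rewrite -{1}[phi]reprK; unlock tofrac.
  rewrite -[LHS]/(FracField.mul _ _) piE; apply/eqmodP.
  by rewrite /= FracField.equivfE /FracField.mulf !numden_Ratio
    ?mulf_neq0 ?oner_neq0 // !mulr1 mulrC.
have nE : n = ratnum phi * gcdp n d by rewrite divpK ?dvdp_gcdl.
have dE : d = ratden phi * gcdp n d by rewrite divpK ?dvdp_gcdr.
apply: (canRL (mulfK _)); first by rewrite tofrac_eq0 ratden_neq0.
apply: (@mulIf _ (tofrac (gcdp n d))); first by rewrite tofrac_eq0.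
by rewrite -mulrA -!tofracM -nE -dE.
Qed.

(* Because the representation is in lowest terms, x is a pole of phi exactly
   when (ratden phi).[x] = 0; there [rateval phi x] is 0, since 0^-1 = 0. *)
Definition rateval (F : fieldType) (phi : {fraction {poly F}}) (x : F) : F :=
  (ratnum phi).[x] / (ratden phi).[x].

Section NumClosed.
Variable C : numClosedFieldType.
Implicit Types phi : {fraction {poly C}}.

(* A pole on the circle is excluded, as [rateval] vanishes there. *)
Definition unimodular_on_circle phi : Prop :=
  forall z : C, `|z| = 1 -> `|rateval phi z| = 1.

Definition takes_value phi (x w : C) : Prop :=
  rateval phi z @[z --> x^'] --> w.

Definition zeros_in_disk phi : nat :=
  count (fun z : C => `|z| < 1) (poly_roots (ratnum phi)).

Definition poles_in_disk phi : nat :=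
  count (fun z : C => `|z| < 1) (poly_roots (ratden phi)).

Definition pick_matrix (N : nat) (lambda w : 'I_N -> C) : 'M[C]_N :=
  \matrix_(i, j) ((1 - w i * (w j)^*) / (1 - lambda i * (lambda j)^*)).

End NumClosed.

(* Main.v *)
Require Import Defs.
From HB Require Import structures.
From mathcomp Require Import all_boot all_order all_algebra.
From mathcomp Require Import complex.
From mathcomp Require Import reals.
From mathcomp Require Import spectral ring zify.
From mathcomp Require Import classical_sets filter topology normedtype.
Import Order.TTheory GRing.Theory Num.Theory.
Import numFieldNormedType.Exports.
Local Open Scope ring_scope.
Set Implicit Arguments.
Unset Strict Implicit.
Unset Printing Implicit Defensive.

(** Write [star d p] for the polynomial [z ^ d * conj (p (1 / conj z))]. On the
    circle [p] and [star d p] have the same modulus, so [p / star d p] is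
    unimodular, and it solves the problem as soon as, at every node,
    [p = w * star d p] and [star d p <> 0]. Two facts give the theorem. Let
    [z] be the number of zero eigenvalues of the Pick matrix.

    Existence in degree [d = N + z] ([exists_self_reflective]). The equations
    are real-linear in [p], and a real vector space is not a finite union of
    proper subspaces, so it is enough to make [star d p] nonzero at one node at
    a time. If that were impossible, evaluation at the node would be a linear
    combination of the interpolation conditions. Testing this relation on
    suitable polynomials yields a nonzero vector [y] all of whose moments
    [sum_j y_j * s (conj lambda_j)], with [deg s <= z], vanish, and, by the
    displacement structure of the Pick matrix, [z + 1] linearly parametrised
    vectors in its kernel obtained from [y] by multiplying the entries by
    polynomials. As the kernel has dimension [z], some nonzero polynomial of
    degree at most [z] vanishes on the support of [y]; then the moments force
    [y = 0] ([no_dual_relation]).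

    Counting is automatic. In lowest terms the quotient is a unimodular constant
    times a quotient of Blaschke products with [a] zeros and [b] poles,
    [a + b = e <= N + z] ([blaschke_factorization]). The identity
    [D D' - B B' = (1 - x y') sum_k t_k t_k'] for a Blaschke product [B / D]
    (primes denote conjugates at the second point) writes the Pick matrix as
    [E E' - F F'] with [E] of width [a] and [F] of width [b]
    ([pick_matrix_split]). Hence [a] is at least the number of positive and [b]
    at least the number of negative eigenvalues. If [e < N], then
    [b = e - a <= N - npos]. If [e >= N], the rows of [E] and [F] side by side
    are independent, so the kernel of the Pick matrix is isotropic for a
    nondegenerate form and is counted on both sides: [a >= npos + z]
    ([eigenvalue_counts]), and again [b <= N + z - a <= N - npos]. Zeros are
    bounded in the same way. *)

(** * Reversal of polynomials at a formal degree *)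

Section Reversal.
Variable F : fieldType.
Implicit Types (p q : {poly F}) (d : nat).

Definition reversal d p : {poly F} := \poly_(l < d.+1) p`_(d - l).

Lemma coef_reversal d p k :
  (reversal d p)`_k = if (k <= d)%N then p`_(d - k) else 0.
Proof. by rewrite coef_poly ltnS. Qed.

Lemma size_reversal d p : (size (reversal d p) <= d.+1)%N.
Proof. exact: size_poly. Qed.

Lemma reversalK d p : (size p <= d.+1)%N -> reversal d (reversal d p) = p.
Proof.
move=> sp; apply/polyP=> k; rewrite !coef_reversal leq_subr.
case: leqP => [kd|dk]; first by rewrite subKn.
by rewrite nth_default // (leq_trans sp).
Qed.

Lemma reversalD d p q : reversal d (p + q) = reversal d p + reversal d q.
Proof.
by apply/polyP=> k; rewrite coefD !coef_reversal coefD; case: ifP; rewrite ?addr0.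
Qed.

Lemma reversalZ d c p : reversal d (c *: p) = c *: reversal d p.
Proof.
by apply/polyP=> k; rewrite coefZ !coef_reversal coefZ; case: ifP; rewrite ?mulr0.
Qed.

Lemma reversal0 d : reversal d 0 = 0.
Proof. by rewrite -[0 in LHS](scale0r 0) reversalZ scale0r. Qed.

Lemma reversalC c : reversal 0 c%:P = c%:P.
Proof. by apply/polyP=> k; rewrite coef_reversal !coefC; case: k. Qed.

Lemma reversal_sum d (I : Type) (r : seq I) (G : I -> {poly F}) :
  reversal d (\sum_(i <- r) G i) = \sum_(i <- r) reversal d (G i).
Proof.
by elim/big_rec2: _ => [|i x y _ <-]; rewrite ?reversal0 ?reversalD.
Qed.

Lemma reversalXnM a b i q : (i <= a)%N -> (size q <= b.+1)%N ->
  reversal (a + b) ('X^i * q) = 'X^(a - i) * reversal b q.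
Proof.
move=> ia sq; apply/polyP=> k; rewrite coef_reversal !coefXnM coef_reversal.
case: (leqP k (a + b)) => kab; last first.
  by rewrite ifF ?ifF //; lia.
case: (ltnP (a + b - k) i) => h1.
  rewrite ifF; last by lia.
  by rewrite ifF //; lia.
case: (ltnP k (a - i)) => h2.
  by rewrite nth_default // (leq_trans sq) //; lia.
by rewrite ifT; [congr (q`_ _); lia | lia].
Qed.

(** Reversal at formal degree [d] is [p |-> 'X^d * p(1/'X)], hence
    multiplicative when formal degrees are added. *)
Lemma reversalM a b p q : (size p <= a.+1)%N -> (size q <= b.+1)%N ->
  reversal (a + b) (p * q) = reversal a p * reversal b q.
Proof.
move=> sp sq.
have pE : p = \sum_(i < a.+1) p`_i *: 'X^i.
  by rewrite -poly_def; apply/polyP=> k; rewrite coef_poly; case: ltnP => // h;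
    rewrite nth_default // (leq_trans sp).
have oneb : (size (1%R : {poly F}) <= 1)%N by rewrite size_poly1.
rewrite pE mulr_suml !reversal_sum mulr_suml; apply: eq_bigr => i _.
rewrite -scalerAl !reversalZ -scalerAl reversalXnM ?leq_ord //.
have := @reversalXnM a 0 i 1 (leq_ord i) oneb.
rewrite addn0 mulr1 => ->; congr (_ *: (_ * _)).
by rewrite -polyC1 reversalC polyC1 mulr1.
Qed.

Lemma reversal_XsubC c : reversal 1 ('X - c%:P) = 1 - c *: 'X.
Proof.
apply/polyP=> k; rewrite coef_reversal !coefB coefZ !coefX !coefC.
by case: k => [|[|k]] /=; rewrite ?mulr0n ?mulr1n ?mulr0 ?mulr1 ?subr0.
Qed.

Lemma reversal_prod_XsubC (I : Type) (r : seq I) (c : I -> F) :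
  reversal (size r) (\prod_(i <- r) ('X - (c i)%:P))
  = \prod_(i <- r) (1 - c i *: 'X).
Proof.
elim: r => [|i r IH]; first by rewrite !big_nil; apply: reversalC.
rewrite !big_cons /= -add1n reversalM ?size_XsubC ?size_prod_XsubC //.
by rewrite IH reversal_XsubC.
Qed.

Lemma horner_reversal d p x :
  (reversal d p).[x] = \sum_(l < d.+1) p`_l * x ^+ (d - l).
Proof.
rewrite horner_poly (reindex_inj rev_ord_inj) /=.
by apply: eq_bigr => l _; rewrite subSS subKn ?leq_ord.
Qed.

Lemma horner_1subZX a x : (1 - a *: 'X : {poly F}).[x] = 1 - a * x.
Proof. by rewrite !hornerE. Qed.

End Reversal.

(** * Interpolating pairs over a field *)

Section DualPairs.

Lemma row_space_duality (F : fieldType) (m n : nat) (A : 'M[F]_(m, n))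
    (b : 'rV[F]_n) :
  (exists y, b = y *m A) \/ exists x : 'cV[F]_n, A *m x = 0 /\ b *m x != 0.
Proof.
case: (boolP (b <= A)%MS) => [/submxP|]; first by left.
rewrite submxE => /matrix0Pn[i [j bj]]; right; exists (col j (cokermx A)).
split; first by rewrite colE mulmxA mulmx_coker mul0mx.
by apply/matrix0Pn; exists i, 0; rewrite colE mulmxA -colE mxE.
Qed.

Variable F : fieldType.

Section DualRelation.
Variables (N z : nat) (lam mu w v : 'I_N -> F) (i : 'I_N).
Hypotheses (lam_inj : injective lam) (mu_inj : injective mu).
Hypothesis lam_mu : forall j k, 1 - lam j * mu k != 0.
Let Gam : 'M[F]_N :=
  \matrix_(j, k) ((1 - w j * v k) / (1 - lam j * mu k)).
Hypothesis rankGam : (N - z <= \rank Gam)%N.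
Variables (al be : 'I_N -> F).
Let d := (N + z)%N.
Hypothesis relP : forall P : {poly F}, (size P <= d.+1)%N ->
  \sum_j al j * P.[lam j] = \sum_j be j * (v j * (reversal d P).[mu j]).
Hypothesis relQ : forall Q : {poly F}, (size Q <= d.+1)%N ->
  Q.[lam i] + \sum_j al j * (w j * Q.[lam j])
  = \sum_j be j * (reversal d Q).[mu j].

Let om : {poly F} := \prod_(j < N) ('X - (lam j)%:P).
Let ell m : {poly F} := \prod_(j < N | j != m) ('X - (lam j)%:P).
Let omr := reversal N om.

Let omE m : om = ('X - (lam m)%:P) * ell m.
Proof. by rewrite /om (bigD1 m). Qed.

Let size_om : size om = N.+1.
Proof. by rewrite size_prod_XsubC -[index_enum _]enumT size_enum_ord. Qed.

Let size_ell m : size (ell m) = N.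
Proof.
have := size_om; rewrite (omE m) size_monicM ?monicXsubC ?size_XsubC //.
  by rewrite !add2n => -[].
by rewrite monic_neq0 // monic_prod_XsubC.
Qed.

Let om_lam j : om.[lam j] = 0.
Proof. by rewrite (omE j) hornerM hornerXsubC subrr mul0r. Qed.

Let ell_lam m j : j != m -> (ell m).[lam j] = 0.
Proof.
by move=> jm; rewrite /ell (bigD1 j) //= hornerM hornerXsubC subrr mul0r.
Qed.

Let ell_self m : (ell m).[lam m] != 0.
Proof.
rewrite horner_prod; apply/prodf_neq0 => j jm.
by rewrite hornerXsubC subr_eq0; apply: contra jm => /eqP/lam_inj ->.
Qed.

Let omr_mu j : omr.[mu j] != 0.
Proof.
have -> : omr = \prod_k (1 - lam k *: 'X).
  have sI : size (index_enum 'I_N) = N by rewrite -[index_enum _]enumT size_enum_ord.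
  by rewrite -reversal_prod_XsubC sI.
rewrite horner_prod; apply/prodf_neq0 => k _.
by rewrite !hornerE lam_mu.
Qed.

Let N_gt0 : (0 < N)%N. Proof. exact: leq_ltn_trans (ltn_ord i). Qed.

Let omrE m : omr = (1 - lam m *: 'X) * reversal N.-1 (ell m).
Proof.
have -> : omr = reversal (1 + N.-1) om by rewrite add1n prednK.
rewrite (omE m) reversalM ?size_XsubC ?size_ell ?prednK //.
by rewrite reversal_XsubC.
Qed.

Let y j := be j * omr.[mu j].

(** Test [relQ] on [Q = om * t], which vanishes at the nodes [lam]. *)
Let moments (s : {poly F}) : (size s <= z.+1)%N ->
  \sum_j y j * s.[mu j] = 0.
Proof.
move=> ss; rewrite -(reversalK ss); set t := reversal z s.
have st : (size t <= z.+1)%N by exact: size_reversal.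
have sot : (size (om * t)%R <= d.+1)%N.
  by apply: leq_trans (size_polyMleq _ _) _; rewrite size_om /d; lia.
have := relQ sot; rewrite hornerM om_lam mul0r add0r big1 => [e|j _]; last first.
  by rewrite hornerM om_lam mul0r !mulr0.
rewrite [RHS]e; apply: eq_bigr => j _.
by rewrite reversalM ?size_om // hornerM mulrA.
Qed.

(** Test both relations on [ell m * ('X - lam i) * t], which vanishes at [lam i]
    and at every node but [lam m]; eliminating [al m] between them produces row
    [m] of [Gam], as [omr / (1 - lam m * 'X)] is the reversal of [ell m]. *)
Let kernel (s : {poly F}) : (size s <= z.+1)%N -> forall m,
  \sum_j Gam m j * (y j * (1 - lam i * mu j) * s.[mu j]) = 0.
Proof.
move=> ss m; rewrite -(reversalK ss); set t := reversal z s.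
have st : (size t <= z.+1)%N by exact: size_reversal.
pose T := ell m * (('X - (lam i)%:P) * t).
have sXt : (size (('X - (lam i)%:P) * t)%R <= z.+2)%N.
  by apply: leq_trans (size_polyMleq _ _) _; rewrite size_XsubC.
have sT : (size T <= d.+1)%N.
  apply: leq_trans (size_polyMleq _ _) _; rewrite size_ell.
  move: N_gt0 sXt; set k := size _; rewrite /d; clear; lia.
have revT : reversal d T
    = reversal N.-1 (ell m) * ((1 - lam i *: 'X) * reversal z t).
  have -> : d = (N.-1 + (1 + z))%N by rewrite /d; lia.
  by rewrite reversalM ?size_ell ?prednK // reversalM ?size_XsubC //
     reversal_XsubC.
have T_i : T.[lam i] = 0 by rewrite !hornerM hornerXsubC subrr mul0r mulr0.
have T_j j : j != m -> T.[lam j] = 0 by move=> jm; rewrite hornerM ell_lam ?mul0r.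
have eP := relP sT; have eQ := relQ sT.
rewrite (bigD1 m) //= big1 ?addr0 in eP; last by move=> j /T_j ->; rewrite mulr0.
rewrite T_i add0r (bigD1 m) //= big1 ?addr0 in eQ; last first.
  by move=> j /T_j ->; rewrite !mulr0.
suff : \sum_j be j * (reversal d T).[mu j]
     - w m * \sum_j be j * (v j * (reversal d T).[mu j])
     = \sum_j Gam m j * (y j * (1 - lam i * mu j) * (reversal z t).[mu j]).
  by move=> <-; rewrite -eQ -eP; ring.
rewrite mulr_sumr -sumrB; apply: eq_bigr => j _.
have := lam_mu m j; rewrite /y revT (omrE m) !mxE !hornerM !horner_1subZX => lm.
by field.
Qed.

(** In [relP] and [relQ], [al] and [be] are the coefficients of a relation that
    expresses [Q |-> Q(lam i)] through the interpolation conditions. The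
    vectors [y_j * (1 - lam i * mu_j) * s(mu_j)], for the polynomials [s] of
    size at most [z + 1], lie in the kernel of [Gam], of dimension at most [z];
    hence one such nonzero [s] vanishes on the support of [y]. Dividing [s] by
    its factor at a point of the support gives a polynomial that isolates this
    point and contradicts the vanishing of the moments of [y]. *)
Lemma no_dual_relation : False.
Proof.
pose K : 'M[F]_(z.+1, N) :=
  \matrix_(l, j) (y j * (1 - lam i * mu j) * mu j ^+ l).
have KG : (K <= kermx Gam^T)%MS.
  apply/sub_kermxP/matrixP=> l m; rewrite !mxE.
  rewrite -[RHS](@kernel 'X^l _ m) ?size_polyXn //.
  by apply: eq_bigr => j _; rewrite !mxE hornerXn mulrC.
have /rowV0Pn [u /sub_kermxP uK u0] : kermx K != 0.
  rewrite -mxrank_eq0 mxrank_ker subn_eq0 -ltnNge ltnS.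
  apply: leq_trans (mxrankS KG) _; rewrite mxrank_ker mxrank_tr; lia.
pose s := rVpoly u.
have ss : (size s <= z.+1)%N by exact: size_poly.
have s0 : s != 0.
  by apply: contra u0 => /eqP s0; rewrite -(rVpolyK u) -/s s0 linear0.
have ys j : y j * s.[mu j] = 0.
  apply: (mulIf (lam_mu i j)); rewrite mul0r.
  have /matrixP/(_ 0 j) := uK; rewrite !mxE => <-.
  rewrite (horner_coef_wide _ ss) mulr_sumr mulr_suml; apply: eq_bigr => l _.
  by rewrite mxE coef_rVpoly_ord; ring.
have y0 j : y j = 0.
  apply: contraTeq isT => yj.
  have [k [h]] := multiplicity_XsubC s (mu j).
  rewrite s0 /= => hj sE.
  have h0 : h != 0 by apply: contraNneq hj => ->; rewrite root0.
  have sh : (size h <= z.+1)%N.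
    by apply: leq_trans (dvdp_leq s0 _) ss; rewrite sE dvdp_mulr.
  have := moments sh; rewrite (bigD1 j) //= big1 ?addr0 => [/eqP|l lj].
    by rewrite mulf_eq0 (negPf yj) /= -rootE (negPf hj).
  have := ys l; rewrite sE hornerM horner_exp hornerXsubC mulrA => /eqP.
  rewrite mulf_eq0 => /orP[/eqP //|]; rewrite expf_eq0 subr_eq0 => /andP[_ /eqP].
  by move=> /mu_inj lj'; rewrite lj' eqxx in lj.
have be0 j : be j = 0.
  by have /eqP := y0 j; rewrite mulf_eq0 (negPf (omr_mu j)) orbF => /eqP.
have sl m : (size (ell m) <= d.+1)%N by rewrite size_ell /d; lia.
have al0 : al i = 0.
  have := relP (sl i); rewrite (bigD1 i) //= big1 => [|j ji]; last first.
    by rewrite ell_lam ?mulr0.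
  rewrite big1 => [|j _]; last by rewrite be0 mul0r.
  by rewrite addr0 => /eqP; rewrite mulf_eq0 (negPf (ell_self i)) orbF => /eqP.
have := relQ (sl i); rewrite (bigD1 i) //= big1 => [|j ji]; last first.
  by rewrite ell_lam ?mulr0.
rewrite big1 => [|j _]; last by rewrite be0 mul0r.
by rewrite al0 mul0r !addr0 => /eqP; rewrite (negPf (ell_self i)).
Qed.

End DualRelation.

(** For [mu = conj lam] and [v = conj w] the last condition says that also
    [star d Q / star d P] takes the values [w] at [lam], so that the conditions
    are stable under the exchange of [(P, Q)] with [(star d Q, star d P)], whose
    fixed points are the pairs [(p, star d p)]. *)
Definition interpolates (N d : nat) (lam mu w v : 'I_N -> F)
    (P Q : {poly F}) : Prop :=
  [/\ (size P <= d.+1)%N, (size Q <= d.+1)%N,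
      forall j, P.[lam j] = w j * Q.[lam j]
    & forall j, (reversal d Q).[mu j] = v j * (reversal d P).[mu j]].

(** There are [2N] conditions on [2(N + z + 1)] coefficients; by duality the
    conditions leave [Q(lam i)] free unless it is one of their combinations. *)
Lemma exists_interpolating_pair (N z : nat) (lam mu w v : 'I_N -> F)
    (i : 'I_N) :
  injective lam -> injective mu -> (forall j k, 1 - lam j * mu k != 0) ->
  (N - z <= \rank (\matrix_(j, k) ((1 - w j * v k) / (1 - lam j * mu k))
                     : 'M[F]_N))%N ->
  exists P Q, interpolates (N + z) lam mu w v P Q /\ Q.[lam i] != 0.
Proof.
move=> lam_inj mu_inj lam_mu rankG; set d := (N + z)%N.
pose V : 'M[F]_(N, d.+1) := \matrix_(j, l) lam j ^+ l.
pose R : 'M[F]_(N, d.+1) := \matrix_(j, l) mu j ^+ (d - l).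
pose wV : 'M[F]_(N, d.+1) := \matrix_(j, l) (w j * lam j ^+ l).
pose vR : 'M[F]_(N, d.+1) := \matrix_(j, l) (v j * mu j ^+ (d - l)).
pose vec (P : {poly F}) : 'cV[F]_d.+1 := (poly_rV P)^T.
have vec0 : vec 0 = 0 by rewrite /vec linear0 trmx0.
have VE (P : {poly F}) j : (size P <= d.+1)%N -> (V *m vec P) j 0 = P.[lam j].
  move=> sP; rewrite !mxE (horner_coef_wide _ sP).
  by apply: eq_bigr => l _; rewrite !mxE mulrC.
have wVE (P : {poly F}) j : (size P <= d.+1)%N -> (wV *m vec P) j 0 = w j * P.[lam j].
  move=> sP; rewrite -VE // !mxE mulr_sumr.
  by apply: eq_bigr => l _; rewrite !mxE mulrA.
have RE (P : {poly F}) j : (R *m vec P) j 0 = (reversal d P).[mu j].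
  rewrite !mxE horner_reversal.
  by apply: eq_bigr => l _; rewrite !mxE mulrC.
have vRE (P : {poly F}) j : (vR *m vec P) j 0 = v j * (reversal d P).[mu j].
  rewrite -RE !mxE mulr_sumr.
  by apply: eq_bigr => l _; rewrite !mxE mulrA.
pose A := block_mx V (- wV) (- vR) R.
pose b : 'rV[F]_(d.+1 + d.+1) := row_mx 0 (row i V).
case: (row_space_duality A b) => [[y bE]|[x [Ax bx]]].
  have bP P Q : 0 *m vec P + row i V *m vec Q
     = (lsubmx y *m V - rsubmx y *m vR) *m vec P
       + (rsubmx y *m R - lsubmx y *m wV) *m vec Q.
    have := congr1 (mulmx^~ (col_mx (vec P) (vec Q))) bE.
    rewrite /b /A -{1}(hsubmxK y) mul_row_block !mulmxN !mul_row_col => ->.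
    by rewrite [X in _ = _ + X *m _]addrC.
  exfalso.
  apply: (@no_dual_relation N z lam mu w v i lam_inj mu_inj lam_mu rankG
    (fun j => lsubmx y 0 j) (fun j => rsubmx y 0 j)) => [P sP|Q sQ].
    have := bP P 0; rewrite vec0 !mulmx0 !addr0 mul0mx mulmxBl.
    move=> /esym/eqP; rewrite subr_eq0 -!mulmxA => /eqP/matrixP/(_ 0 0).
    rewrite !(mxE _ _ 0 0) => e.
    under eq_bigr do rewrite -VE //.
    by rewrite e; apply: eq_bigr => j _; rewrite vRE.
  have := bP 0 Q; rewrite vec0 !mulmx0 !add0r mulmxBl.
  rewrite -row_mul -!mulmxA => /eqP; rewrite -subr_eq0 opprB addrA subr_eq0.
  move=> /eqP/matrixP/(_ 0 0) e.
  rewrite mxE [X in X + _]mxE VE // !(mxE _ _ 0 0) in e.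
  under [in RHS]eq_bigr do rewrite -RE; rewrite -e.
  by congr (_ + _); apply: eq_bigr => j _; rewrite wVE.
pose P := rVpoly (usubmx x)^T; pose Q := rVpoly (dsubmx x)^T.
have sP : (size P <= d.+1)%N by exact: size_poly.
have sQ : (size Q <= d.+1)%N by exact: size_poly.
have xE : x = col_mx (vec P) (vec Q).
  by rewrite /vec /P /Q !rVpolyK !trmxK vsubmxK.
move: Ax bx; rewrite xE mul_block_col mul_row_col mul0mx add0r.
rewrite -[0 in X in X -> _]col_mx0 => /eq_col_mx [PQ QP] bx.
exists P, Q; split; last first.
  apply: contraNneq bx => Q0; apply/eqP/matrixP=> k l; rewrite !ord1.
  by rewrite -row_mul mxE VE // Q0 mxE.
split=> // j.
- move/eqP: PQ; rewrite mulNmx subr_eq0 => /eqP/matrixP/(_ j 0).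
  by rewrite VE // wVE.
- move/eqP: QP; rewrite mulNmx addrC subr_eq0 => /eqP/matrixP/(_ j 0).
  by rewrite RE vRE.
Qed.

End DualPairs.

(** * Reflection in the unit circle *)

Section Star.
Variable C : numClosedFieldType.
Implicit Types (p q : {poly C}) (d : nat).

Definition star d p : {poly C} := map_poly Num.conj (reversal d p).

Lemma size_star d p : (size (star d p) <= d.+1)%N.
Proof. by rewrite size_map_poly size_reversal. Qed.

Lemma coef_star d p k :
  (star d p)`_k = if (k <= d)%N then (p`_(d - k))^* else 0.
Proof. by rewrite coef_map /= coef_reversal; case: ifP; rewrite ?rmorph0. Qed.

Lemma starK d p : (size p <= d.+1)%N -> star d (star d p) = p.
Proof.
move=> sp; apply/polyP=> k; rewrite !coef_star leq_subr.
case: leqP => [kd|dk]; first by rewrite subKn ?conjCK.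
by rewrite nth_default // (leq_trans sp).
Qed.

Lemma starD d p q : star d (p + q) = star d p + star d q.
Proof. by rewrite /star reversalD rmorphD. Qed.

Lemma starZ d c p : star d (c *: p) = c^* *: star d p.
Proof. by rewrite /star reversalZ map_polyZ. Qed.

Lemma star_sum d (I : Type) (r : seq I) (G : I -> {poly C}) :
  star d (\sum_(i <- r) G i) = \sum_(i <- r) star d (G i).
Proof. by rewrite /star reversal_sum rmorph_sum. Qed.

Lemma starM a b p q : (size p <= a.+1)%N -> (size q <= b.+1)%N ->
  star (a + b) (p * q) = star a p * star b q.
Proof. by move=> sp sq; rewrite /star reversalM // rmorphM. Qed.

Lemma star_eq0 d p : (size p <= d.+1)%N -> (star d p == 0) = (p == 0).
Proof.
move=> sp; apply/eqP/eqP=> [s0|->]; last first.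
  by rewrite -[0 in LHS](scale0r 0) starZ rmorph0 scale0r.
by rewrite -(starK sp) s0 -[0 in LHS](scale0r 0) starZ rmorph0 scale0r.
Qed.

Lemma horner_star_conj d p x : (star d p).[x^*] = (reversal d p).[x]^*.
Proof. by rewrite horner_map. Qed.

Lemma horner_star_circle d p x : (size p <= d.+1)%N -> `|x| = 1 ->
  (star d p).[x] = x ^+ d * (p.[x])^*.
Proof.
move=> sp x1; have xx : x * x^* = 1 by rewrite -normCK x1 expr1n.
rewrite -[X in _.[X]]conjCK horner_star_conj horner_reversal.
rewrite (horner_coef_wide _ sp) !rmorph_sum mulr_sumr; apply: eq_bigr => l _.
rewrite !rmorphM !rmorphXn /= conjCK mulrCA; congr (_ * _).
have ld : (l <= d)%N by rewrite -ltnS.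
have -> : x ^+ d = x ^+ (d - l) * x ^+ l by rewrite -exprD subnK.
by rewrite -mulrA -exprMn xx expr1n mulr1.
Qed.

(** The linear factors of a Blaschke denominator: the root is the reflection in
    the circle of [a], and there is none when [a = 0]. *)
Definition refl_factor (a : C) : {poly C} := 1 - a^* *: 'X.

Lemma horner_refl_factor a x : (refl_factor a).[x] = 1 - a^* * x.
Proof. exact: horner_1subZX. Qed.

Lemma star_XsubC a : star 1 ('X - a%:P) = refl_factor a.
Proof.
by rewrite /star reversal_XsubC /refl_factor rmorphB rmorph1 /= map_polyZ map_polyX.
Qed.

Lemma size_refl_factor a : (size (refl_factor a) <= 2)%N.
Proof. by rewrite -star_XsubC size_star. Qed.

End Star.

(** * Existence of a self-reflective interpolant *)

Lemma exists_nat_nonroot (F : numDomainType) (p : {poly F}) :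
  p != 0 -> exists n : nat, p.[n%:R] != 0.
Proof.
move=> p0; pose rs := [seq (n%:R : F) | n <- iota 0 (size p)].
case: (altP (@allP _ (root p) rs)) => [/allP rs_root|].
  have rs_uniq : uniq rs.
    by rewrite map_inj_uniq ?iota_uniq // => m n /eqP; rewrite eqr_nat => /eqP.
  by have := max_poly_roots p0 rs_root rs_uniq; rewrite size_map size_iota ltnn.
by case/allPn=> x /mapP[n _ ->] pn; exists n.
Qed.

Lemma disk_mul_neq1 (R : numDomainType) (a b : R) :
  `|a| < 1 -> `|b| <= 1 -> 1 - a * b != 0.
Proof.
move=> a1 b1; rewrite subr_eq0; apply/eqP => ab.
have : `|a * b| < 1 by rewrite normrM; apply: le_lt_trans (ler_piMr (normr_ge0 a) b1) a1.
by rewrite -ab normr1 ltxx.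
Qed.

Section SelfReflective.
Variables (C : numClosedFieldType) (N : nat) (lam w : 'I_N -> C).
Hypotheses (lam_inj : injective lam) (lam_disk : forall i, `|lam i| < 1).

(** Where the denominator does not vanish, the equations say that
    [p / star d p], which has modulus one on the circle, takes the values [w] at
    the points [lam]. They are linear over the reals only. *)
Definition self_reflective (d : nat) (p : {poly C}) : Prop :=
  (size p <= d.+1)%N /\ forall j, p.[lam j] = w j * (star d p).[lam j].

(** From a pair [(P, Q)] one gets the real and imaginary parts
    [P + star d Q] and ['i (P - star d Q)]; both denominators vanish at a node
    only if [Q] does. *)
Lemma self_reflective_at (z : nat) (i : 'I_N) :
  (N - z <= \rank (pick_matrix lam w))%N ->
  exists p, self_reflective (N + z) p /\ (star (N + z) p).[lam i] != 0.
Proof.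
move=> rankG; set d := (N + z)%N.
have conj_inj : injective (fun j => (lam j)^*).
  by move=> j k /(can_inj (@conjCK C))/lam_inj.
have lamlam j k : 1 - lam j * (lam k)^* != 0.
  by apply: disk_mul_neq1; rewrite ?norm_conjC ?ltW.
have [P [Q [[sP sQ PQ QP] Qi]]] :=
  exists_interpolating_pair i lam_inj conj_inj lamlam rankG.
have sQP j : (star d Q).[lam j] = w j * (star d P).[lam j].
  by rewrite -{1 2}[lam j]conjCK !horner_star_conj QP rmorphM /= conjCK.
pose p1 := P + star d Q; pose p2 := 'i *: (P - star d Q).
have s1 : star d p1 = star d P + Q by rewrite starD starK.
have s2 : star d p2 = 'i *: (Q - star d P).
  rewrite starZ starD -scaleN1r starZ starK // conjCi rmorphN rmorph1 scaleN1r.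
  by rewrite scaleNr -scalerN opprB.
have h1 : self_reflective d p1.
  split; first by rewrite (leq_trans (size_polyD _ _)) // geq_max sP size_star.
  by move=> j; rewrite s1 !hornerD PQ sQP; ring.
have h2 : self_reflective d p2.
  split.
    rewrite (leq_trans (size_scale_leq _ _)) // (leq_trans (size_polyD _ _)) //.
    by rewrite geq_max sP size_polyN size_star.
  by move=> j; rewrite s2 !hornerZ !hornerD !hornerN PQ sQP; ring.
case: (eqVneq (star d p1).[lam i] 0) => [z1|]; last by exists p1.
exists p2; split=> //; apply: contra Qi => /eqP z2.
move: z1 z2; rewrite s1 s2 hornerZ !hornerD hornerN => z1 /eqP.
rewrite mulf_eq0 (negPf (neq0Ci _)) /= => /eqP z2.
have : 2 * Q.[lam i] = 0 by rewrite -[RHS]addr0 -{1}z1 -z2; ring.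
by move/eqP; rewrite mulf_eq0 pnatr_eq0.
Qed.

(** A real vector space is not a finite union of proper subspaces: the
    combination with coefficients [t ^+ i] avoids them all for some [t]. *)
Lemma exists_self_reflective (z : nat) :
  (N - z <= \rank (pick_matrix lam w))%N ->
  exists p, [/\ p != 0, self_reflective (N + z) p
              & forall i, (star (N + z) p).[lam i] != 0].
Proof.
move=> rankG; set d := (N + z)%N.
have [G hG] := fin_all_exists (fun i => self_reflective_at i rankG).
pose q j := rVpoly (\row_i (star d (G i)).[lam j]).
have q0 j : q j != 0.
  apply/eqP => qj; have [_] := hG j.
  have := congr1 (fun r : {poly C} => r`_j) qj.
  by rewrite /q coef_rVpoly_ord mxE coef0 => ->; rewrite eqxx.
have /exists_nat_nonroot[n] : \prod_j q j != 0 by apply/prodf_neq0.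
rewrite horner_prod => /prodf_neq0 qn; set t : C := n%:R in qn.
pose p := \sum_(i < N) t ^+ i *: G i.
have starp : star d p = \sum_(i < N) t ^+ i *: star d (G i).
  by rewrite star_sum; apply: eq_bigr => i _; rewrite starZ rmorphXn rmorph_nat.
have p_lam j : (star d p).[lam j] = (q j).[t].
  rewrite starp horner_sum (horner_coef_wide _ (size_poly _ _)).
  by apply: eq_bigr => i _; rewrite hornerZ coef_rVpoly_ord mxE mulrC.
have p_ok : self_reflective d p.
  split=> [|j].
    apply: leq_trans (size_sum _ _ _) _; apply/bigmax_leqP => i _.
    by apply: leq_trans (size_scale_leq _ _) _; have [[]] := hG i.
  rewrite starp !horner_sum mulr_sumr; apply: eq_bigr => i _.
  by have [[_ hi] _] := hG i; rewrite !hornerZ hi; ring.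
case: (posnP N) => [N0|N_gt0].
  exists 1; split=> [||i]; first exact: oner_neq0.
    by split=> [|j]; [rewrite size_poly1 | have := ltn_ord j; rewrite {2}N0].
  by have := ltn_ord i; rewrite {2}N0.
exists p; split=> // [|i]; last by rewrite p_lam qn.
have := qn (Ordinal N_gt0) isT; rewrite -p_lam; apply: contraNneq => p0.
have -> : star d p = 0 by apply/eqP; rewrite star_eq0 ?p0 ?size_poly0.
by rewrite horner0.
Qed.

End SelfReflective.

(** * Spectral counting *)

Section Inertia.
Variable C : numClosedFieldType.
Local Open Scope sesquilinear_scope.

Lemma similar_char_poly (F : fieldType) (N : nat) (A B U : 'M[F]_N) :
  U \in unitmx -> U *m A = B *m U -> char_poly A = char_poly B.
Proof.
move=> Uu UA; pose V := map_mx polyC U.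
have V0 : \det V != 0.
  by rewrite det_map_mx polyC_eq0 -unitfE -unitmxE.
have UP : V *m char_poly_mx A = char_poly_mx B *m V.
  rewrite /char_poly_mx mulmxBr mulmxBl -!map_mxM UA; congr (_ - _).
  by rewrite scalar_mxC.
apply: (mulfI V0); rewrite /char_poly -det_mulmx UP det_mulmx.
by rewrite mulrC.
Qed.

Lemma spectral_unitary_diag (N : nat) (A : 'M[C]_N) :
  (forall i j, A i j = (A j i)^*) ->
  exists U (d : 'rV[C]_N),
    U \is unitarymx /\ U *m A = diag_mx d *m U.
Proof.
move=> Aherm; exists (spectralmx A), (spectral_diag A).
have Ah : A \is hermsymmx.
  by apply/is_hermitianmxP; rewrite expr0 scale1r; apply/matrixP=> i j; rewrite !mxE.
split; first exact: spectral_unitarymx.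
have /orthomx_spectralP AE := hermitian_normalmx Ah.
by rewrite {2}AE !mulmxA mulmxV ?spectral_unit // mul1mx.
Qed.

Lemma count_eigenvalues_diag (N : nat) (A U : 'M[C]_N) (d : 'rV[C]_N)
    (a : pred C) :
  U \in unitmx -> U *m A = diag_mx d *m U ->
  count a (eigenvalues A) = #|[pred i | a (d 0 i)]|.
Proof.
move=> Uu UA.
have : perm_eq (eigenvalues A) [seq d 0 i | i <- index_enum 'I_N].
  apply: prod_XsubC_eq; rewrite -eigenvaluesE (similar_char_poly Uu UA).
  rewrite char_poly_trig ?diag_mx_is_trig // big_map.
  by apply: eq_bigr => i _; rewrite mxE eqxx.
move=> /permP ->; rewrite count_map -sum1_count -sum1_card.
exact: eq_bigl.
Qed.

Lemma rank_diagonalised (N : nat) (A U : 'M[C]_N) (d : 'rV[C]_N) :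
  U \in unitmx -> U *m A = diag_mx d *m U ->
  (N - #|[pred i | d 0%R i == 0%R]| <= \rank A)%N.
Proof.
move=> Uu UA; set T := [pred i | _].
have -> : (N - #|T|)%N = #|[predC T]|.
  apply: (@addnI #|T|); rewrite cardC card_ord subnKC //.
  by rewrite -[leqRHS](card_ord N) max_card.
have -> : \rank A = \rank (diag_mx d).
  have [Ufree Ufull] : row_free U /\ row_full U.
    by rewrite row_free_unit row_full_unit.
  by rewrite -(mxrankMfree (diag_mx d) Ufree) -UA (eqmxMfull A Ufull).
pose f (k : 'I_#|[predC T]|) := enum_val k.
have rf : row_free (rowsub f (diag_mx d)).
  apply/row_freeP; exists (colsub f (diag_mx (map_mx GRing.inv d))).
  apply/matrixP=> k l; rewrite !mxE (bigD1 (f k)) //= big1 => [|j jk].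
    rewrite !mxE eqxx addr0 mulr1n.
    have [<-|kl] := eqVneq k l.
      by rewrite eqxx mulr1n divff //; have := enum_valP k.
    by rewrite (inj_eq enum_val_inj) (negPf kl) mulr0n mulr0.
  by rewrite !mxE eq_sym (negPf jk) mulr0n mul0r.
move/eqP: rf => <-; apply: mxrankS.
have -> : rowsub f (diag_mx d) = rowsub f 1%:M *m diag_mx d.
  by rewrite mul_rowsub_mx mul1mx.
exact: submxMl.
Qed.

Lemma diag_form (N : nat) (y d : 'rV[C]_N) :
  (y *m diag_mx d *m y ^t*) 0 0 = \sum_i d 0 i * `|y 0 i| ^+ 2.
Proof.
by rewrite mul_mx_diag mxE; apply: eq_bigr => i _; rewrite !mxE normCK; ring.
Qed.

Lemma row_sqnorm_le0 (p : nat) (x : 'rV[C]_p) :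
  (x *m x ^t*) 0 0 <= 0 -> x = 0.
Proof.
rewrite mxE (eq_bigr (fun k => `|x 0 k| ^+ 2)) => [s0|k _]; last first.
  by rewrite !mxE normCK.
have /eqP : \sum_k `|x 0 k| ^+ 2 = 0.
  by apply: le_anti; rewrite s0 sumr_ge0 // => k _; rewrite exprn_ge0.
rewrite psumr_eq0 => [/allP x0|k _]; last by rewrite exprn_ge0.
apply/matrixP=> i k; rewrite ord1 mxE; apply/eqP.
by have := x0 k (mem_index_enum _); rewrite expf_eq0 normr_eq0.
Qed.

(** On the span of the eigenvectors selected by [T] the form [A] is
    nonpositive. If that span had dimension more than [q], it would contain a
    nonzero [x] with [x F = 0], where the form equals the squared norm of [x E],
    so that [x E = 0] as well, against the last hypothesis. *)
Lemma inertia_bound (N p q : nat) (A U : 'M[C]_N) (d : 'rV[C]_N)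
    (E : 'M[C]_(N, p)) (F : 'M[C]_(N, q)) (T : pred 'I_N) :
  U \is unitarymx -> U *m A = diag_mx d *m U ->
  A = E *m E ^t* - F *m F ^t* ->
  (forall i, T i -> d 0 i <= 0) ->
  (forall y : 'rV_N, (forall i, ~~ T i -> y 0 i = 0) ->
    y *m U *m E = 0 -> y *m U *m F = 0 -> y = 0) ->
  (#|T| <= q)%N.
Proof.
move=> Uu UA AE dT inj; rewrite leqNgt; apply/negP => qT.
pose S : 'M[C]_(#|T|, N) := \matrix_(k, i) (enum_val k == i)%:R.
have /rowV0Pn [u /sub_kermxP uF u0] : kermx (S *m U *m F) != 0.
  rewrite -mxrank_eq0 mxrank_ker subn_eq0 -ltnNge.
  exact: leq_ltn_trans (rank_leq_col _) qT.
pose y := u *m S.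
have y_off i : ~~ T i -> y 0 i = 0.
  move=> Ti; rewrite mxE big1 // => k _; rewrite mxE.
  case: eqP => [e|_]; last by rewrite mulr0.
  by have := enum_valP k; rewrite e unfold_in (negPf Ti).
have yF : y *m U *m F = 0 by rewrite -uF !mulmxA.
suff yE : y *m U *m E = 0.
  case/negP: u0; apply/eqP/matrixP=> k l; rewrite ord1 mxE.
  have /matrixP/(_ 0 (enum_val l)) := inj y y_off yE yF.
  rewrite !mxE (bigD1 l) //= big1 ?addr0 => [|m ml].
    by rewrite mxE eqxx mulr1.
  by rewrite mxE (inj_eq enum_val_inj) (negPf ml) mulr0.
have UU : U *m U ^t* = 1%:M by apply/unitarymxP.
have form : (y *m U *m E) *m (y *m U *m E) ^t* = y *m diag_mx d *m y ^t*.
  have : y *m U *m A *m (y *m U) ^t* = y *m diag_mx d *m y ^t*.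
    by rewrite -(mulmxA y U) UA trmx_mul map_mxM !mulmxA -(mulmxA _ U) UU mulmx1.
  rewrite AE mulmxBr mulmxBl !mulmxA yF !mul0mx subr0 => <-.
  by rewrite !trmx_mul !map_mxM !mulmxA.
have le0 : (y *m diag_mx d *m y ^t*) 0 0 <= 0.
  rewrite diag_form; apply: sumr_le0 => i _.
  case: (boolP (T i)) => [Ti|/y_off ->]; last by rewrite normr0 expr0n mulr0.
  by rewrite mulr_le0_ge0 ?dT // exprn_ge0.
by apply: row_sqnorm_le0; rewrite form.
Qed.

End Inertia.

(** * Blaschke quotients *)

Section Blaschke.
Variable C : numClosedFieldType.
Implicit Types (p q n m : {poly C}) (s zs ps : seq C).

Definition disk_zeros p : nat :=
  count (fun x : C => `|x| < 1) (poly_roots p).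

Lemma poly_roots_perm c s p : c != 0 -> p = c *: \prod_(x <- s) ('X - x%:P) ->
  perm_eq (poly_roots p) s.
Proof.
move=> c0 pE; apply: prod_XsubC_eq; apply: (scalerI c0); rewrite -pE.
have -> : c = lead_coef p.
  by rewrite pE lead_coefZ (monicP (monic_prod_XsubC _ _ _)) mulr1.
by rewrite -poly_rootsE.
Qed.

Lemma disk_zerosE c s p : c != 0 -> p = c *: \prod_(x <- s) ('X - x%:P) ->
  disk_zeros p = count (fun x : C => `|x| < 1) s.
Proof. by move=> c0 pE; have /permP := poly_roots_perm c0 pE; apply. Qed.

Lemma disk_zerosM p q : p != 0 -> q != 0 ->
  disk_zeros (p * q) = (disk_zeros p + disk_zeros q)%N.
Proof.
move=> p0 q0; rewrite -count_cat.
apply: (disk_zerosE (c := lead_coef p * lead_coef q)).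
  by rewrite mulf_neq0 ?lead_coef_eq0.
rewrite big_cat /= {1}(poly_rootsE p) {1}(poly_rootsE q).
by rewrite -scalerAl -scalerAr scalerA.
Qed.

Lemma disk_zerosC c : c != 0 -> disk_zeros c%:P = 0%N.
Proof.
move=> c0; rewrite (disk_zerosE (c := c) (s := [::])) //.
by rewrite big_nil alg_polyC.
Qed.

Lemma disk_zeros_prod (I : eqType) (r : seq I) (G : I -> {poly C}) :
  (forall i, G i != 0) ->
  disk_zeros (\prod_(i <- r) G i) = (\sum_(i <- r) disk_zeros (G i))%N.
Proof.
move=> G0; elim: r => [|i r IH].
  by rewrite !big_nil -polyC1 disk_zerosC ?oner_neq0.
by rewrite !big_cons disk_zerosM ?IH // prodf_seq_neq0; apply/allP=> x _; apply: G0.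
Qed.

Lemma disk_zeros_XsubC x : disk_zeros ('X - x%:P) = (`|x| < 1).
Proof.
rewrite (disk_zerosE (c := 1) (s := [:: x])) ?oner_neq0 //= ?addn0 //.
by rewrite big_seq1 scale1r.
Qed.

Lemma refl_factor_neq0 (x : C) : refl_factor x != 0.
Proof.
apply: contraNneq (oner_neq0 C) => r0.
by rewrite -[X in _ == X](horner0 0) -r0 horner_refl_factor mulr0 subr0.
Qed.

Lemma refl_factor_inv (r : C) : r != 0 -> 'X - r%:P = - r *: refl_factor (r^*)^-1.
Proof.
move=> r0; rewrite /refl_factor fmorphV /= conjCK scalerBr scalerA mulNr mulfV //.
by rewrite scaleN1r opprK scaleNr alg_polyC addrC.
Qed.

Lemma disk_zeros_refl_factor (b : C) : `|b| < 1 -> disk_zeros (refl_factor b) = 0%N.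
Proof.
move=> b1; case: (eqVneq b 0) => [->|b0].
  rewrite /refl_factor rmorph0 scale0r subr0 -polyC1 disk_zerosC //.
  exact: oner_neq0.
have r0 : (b^*)^-1 != 0 by rewrite invr_neq0 ?conjC_eq0.
have bE : (((b^*)^-1)^*)^-1 = b by rewrite fmorphV /= conjCK invrK.
have e := refl_factor_inv r0; rewrite bE in e.
have z : disk_zeros ('X - (b^*)^-1%:P) = 0%N.
  rewrite disk_zeros_XsubC normrV ?unitfE ?conjC_eq0 // norm_conjC.
  by rewrite invf_lt1 ?normr_gt0 // lt_gtF.
rewrite -z e -mul_polyC disk_zerosM ?disk_zerosC ?oppr_eq0 //.
  by rewrite polyC_eq0 oppr_eq0.
exact: refl_factor_neq0.
Qed.

(** A quotient of finite Blaschke products with zeros [zs] and poles [ps] is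
    [blaschke_num zs ps / blaschke_num ps zs]. *)
Definition blaschke_num zs ps : {poly C} :=
  \prod_(a <- zs) ('X - a%:P) * \prod_(b <- ps) refl_factor b.

Lemma size_prod_refl_factor s :
  (size (\prod_(b <- s) refl_factor b)%R <= (size s).+1)%N.
Proof.
elim: s => [|b s IH]; first by rewrite big_nil size_poly1.
rewrite big_cons; apply: leq_trans (size_polyMleq _ _) _.
have := size_refl_factor b; move: IH => /=; lia.
Qed.

Lemma star_prod_XsubC s :
  star (size s) (\prod_(a <- s) ('X - a%:P)) = \prod_(a <- s) refl_factor a.
Proof.
elim: s => [|a s IH].
  by rewrite !big_nil /star -polyC1 reversalC polyC1 rmorph1.
rewrite !big_cons /= -add1n starM ?size_XsubC ?size_prod_XsubC //.
by rewrite IH star_XsubC.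
Qed.

Lemma star_blaschke_num zs ps :
  star (size zs + size ps) (blaschke_num zs ps) = blaschke_num ps zs.
Proof.
rewrite /blaschke_num starM ?size_prod_XsubC ?size_prod_refl_factor //.
rewrite star_prod_XsubC mulrC -[X in star (size ps) X]star_prod_XsubC.
by rewrite starK ?size_prod_XsubC.
Qed.

Lemma disk_zeros_blaschke_num c zs ps : c != 0 ->
  all (fun x => `|x| < 1) zs -> all (fun x => `|x| < 1) ps ->
  disk_zeros (c *: blaschke_num zs ps) = size zs.
Proof.
move=> c0 hz hp; have X0 (a : C) : 'X - a%:P != 0 by rewrite polyXsubC_eq0.
have p0 : \prod_(a <- zs) ('X - a%:P) != 0 :> {poly C}.
  by rewrite prodf_seq_neq0; apply/allP=> x _; rewrite X0.
have q0 : \prod_(b <- ps) refl_factor b != 0 :> {poly C}.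
  by rewrite prodf_seq_neq0; apply/allP=> x _; rewrite refl_factor_neq0.
rewrite -mul_polyC disk_zerosM ?polyC_eq0 ?mulf_neq0 // disk_zerosC // add0n.
rewrite disk_zerosM // !disk_zeros_prod //; last by exact: refl_factor_neq0.
rewrite [X in (_ + X)%N]big1_seq ?addn0 => [|b /andP[_ /(allP hp)]]; last first.
  exact: disk_zeros_refl_factor.
rewrite -sum1_size; apply: eq_big_seq => a /(allP hz) a1.
by rewrite disk_zeros_XsubC a1.
Qed.

Lemma blaschke_num_neq0 zs ps : blaschke_num zs ps != 0.
Proof.
rewrite mulf_neq0 // prodf_seq_neq0; apply/allP=> x _ /=.
  by rewrite polyXsubC_eq0.
exact: refl_factor_neq0.
Qed.

(** As [n] and [m] are coprime, [n] divides [star e m] and the quotient is a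
    constant: [n] and [m] are, up to constants, each other's reflection. So [n]
    has no zero on the circle, its zeros in the disk are [zs], and the zeros of
    [m] in the disk are the reflections [ps] of the zeros of [n] outside it; each
    degree missing from [n] is a zero of [n] at infinity, reflected to the
    origin. *)
Lemma blaschke_factorization n m : n != 0 -> m != 0 -> coprimep n m ->
  let e := (maxn (size n) (size m)).-1 in
  n * star e n = m * star e m ->
  exists zs ps c c', [/\ all (fun x => `|x| < 1) zs,
    all (fun x => `|x| < 1) ps, (size zs + size ps)%N = e,
    [/\ c != 0, c' != 0 & `|c| = `|c'|]
    & n = c *: blaschke_num zs ps /\ m = c' *: blaschke_num ps zs].
Proof.
move=> n0 m0 nm e nnmm.
have n_gt0 : (0 < size n)%N by rewrite size_poly_gt0.
have m_gt0 : (0 < size m)%N by rewrite size_poly_gt0.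
have sn : (size n <= e.+1)%N by rewrite /e; lia.
have sm : (size m <= e.+1)%N by rewrite /e; lia.
have sn0 : star e n != 0 by rewrite star_eq0.
have sm0 : star e m != 0 by rewrite star_eq0.
have /dvdpP [u uE] : n %| star e m.
  by rewrite -(Gauss_dvdpr _ nm) -nnmm dvdp_mulr.
have uE' : star e n = u * m by apply: (mulfI n0); rewrite nnmm uE; ring.
have u0 : u != 0 by apply: contraNneq sm0 => z; rewrite uE z mul0r.
(* One of [n] and [m] has degree exactly [e], and [u] multiplies both within
   degree [e]. *)
have su : (size u <= 1)%N.
  have u_gt0 : (0 < size u)%N by rewrite size_poly_gt0.
  have := size_star e n; have := size_star e m.
  rewrite uE uE' !size_mul // /e; move: u_gt0 n_gt0 m_gt0.
  by set a := size u; set b := size n; set b' := size m; clear; lia.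
have [k uk] : exists k, u = k%:P by exists u`_0; apply: size1_polyC.
have k0 : k != 0 by apply: contraNneq u0 => z; rewrite uk z.
rewrite uk mul_polyC in uE; rewrite uk mul_polyC in uE'.
pose rs := poly_roots n; pose zs := [seq r <- rs | `|r| < 1].
pose os := [seq r <- rs | ~~ (`|r| < 1)].
have os_out r : r \in os -> 1 < `|r|.
  rewrite mem_filter => /andP[r1 rr]; rewrite real_ltNge ?normr_real //.
  have rn : root n r.
    by rewrite (poly_rootsE n) rootZ ?lead_coef_eq0 // root_prod_XsubC.
  apply/negP=> r1'; have {}r1 : `|r| = 1.
    by apply: le_anti; rewrite r1' real_leNgt ?normr_real ?r1 //.
  have := horner_star_circle sn r1; rewrite (rootP rn) rmorph0 mulr0 uE'.
  rewrite hornerZ => /eqP; rewrite mulf_eq0 (negPf k0) /=.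
  by apply/negP; apply: coprimep_root nm rn.
pose qs := [seq (r^*)^-1 | r <- os].
pose ps := qs ++ nseq (e - size rs) 0.
have srs : size n = (size rs).+1.
  by rewrite {1}(poly_rootsE n) size_scale ?lead_coef_eq0 // size_prod_XsubC.
have srs' : (size zs + size os)%N = size rs by rewrite !size_filter count_predC.
pose c := lead_coef n * \prod_(r <- os) (- r).
have c0 : c != 0.
  rewrite mulf_neq0 ?lead_coef_eq0 // prodf_seq_neq0; apply/allP=> r /os_out r1.
  by rewrite /= oppr_eq0 -normr_eq0 gt_eqF // (lt_trans ltr01).
have nE : n = c *: blaschke_num zs ps.
  rewrite {1}(poly_rootsE n) -/rs /c -scalerA; congr (_ *: _).
  rewrite (bigID (fun r => `|r| < 1)) /= -!(big_filter rs) /blaschke_num.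
  rewrite scalerAr; congr (_ * _).
  rewrite big_cat /= [X in _ * X]big1_seq ?mulr1 => [|b /andP[_]]; last first.
    rewrite mem_nseq => /andP[_ /eqP ->].
    by rewrite /refl_factor rmorph0 scale0r subr0.
  rewrite big_map.
  rewrite -scaler_prod; apply: eq_big_seq => r /os_out r1.
  by rewrite refl_factor_inv // -normr_eq0 gt_eqF // (lt_trans ltr01).
have size_e : (size zs + size ps)%N = e.
  rewrite /ps size_cat size_map size_nseq addnA srs' subnKC //.
  by move: sn; rewrite srs.
have mE : m = (k^-1 * c^*) *: blaschke_num ps zs.
  apply: (scalerI k0); rewrite scalerA mulrA mulfV // mul1r -uE' {1}nE starZ.
  by rewrite -size_e star_blaschke_num.
have k'0 : k^-1 * c^* != 0 by rewrite mulf_neq0 ?invr_neq0 ?conjC_eq0.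
exists zs, ps, c, (k^-1 * c^*); split=> //.
- by apply/allP=> r; rewrite mem_filter => /andP[].
- apply/allP=> b; rewrite mem_cat => /orP[/mapP[r /os_out r1 ->]|]; last first.
    by rewrite mem_nseq => /andP[_ /eqP ->]; rewrite normr0 ltr01.
  have r_gt0 : 0 < `|r| by apply: lt_trans r1.
  rewrite normrV ?unitfE ?conjC_eq0 -?normr_gt0 // norm_conjC invf_lt1 //.
- split=> //; set c' := k^-1 * _ in k'0 mE *.
  have : `|c| ^+ 2 = `|c'| ^+ 2.
    have b0 := mulf_neq0 (blaschke_num_neq0 zs ps) (blaschke_num_neq0 ps zs).
    apply: polyC_inj; apply: (mulIf b0).
    move: nnmm; rewrite nE mE !starZ -size_e star_blaschke_num addnC.
    rewrite star_blaschke_num !mul_polyC !normCK -!scalerAl -!scalerAr !scalerA.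
    by move=> ->; rewrite [X in _ = _ *: X]mulrC.
  by move/eqP; rewrite eqrXn2 // => /eqP.
Qed.

End Blaschke.

(** * The Pick matrix of a Blaschke quotient *)

Section TakenakaMalmquist.
Variable C : numClosedFieldType.
Local Open Scope sesquilinear_scope.
Implicit Types (p q h : {poly C}) (s zs ps : seq C).

Definition refl_prod s : {poly C} := \prod_(a <- s) refl_factor a.

(** The numerators, over the common denominator [refl_prod zs], of the
    Takenaka-Malmquist orthonormal basis of the model space of the Blaschke
    product with zeros [zs]. *)
Fixpoint takenaka zs : seq {poly C} :=
  if zs is a :: s then
    (sqrtC (1 - `|a| ^+ 2) *: refl_prod s)
      :: [seq ('X - a%:P) * e | e <- takenaka s]
  else [::].

Lemma size_takenaka zs : size (takenaka zs) = size zs.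
Proof. by elim: zs => //= a s IH; rewrite size_map IH. Qed.

(** For one linear factor the left-hand side is
    [(1 - |a|^2) (1 - x * conj y)]; for a product it telescopes. *)
Lemma takenaka_kernel zs (x y : C) : all (fun a => `|a| < 1) zs ->
  (refl_prod zs).[x] * ((refl_prod zs).[y])^*
    - (\prod_(a <- zs) ('X - a%:P)).[x] * ((\prod_(a <- zs) ('X - a%:P)).[y])^*
  = (1 - x * y^*) * \sum_(e <- takenaka zs) e.[x] * (e.[y])^*.
Proof.
rewrite /refl_prod; elim: zs => [|a s IH] /=.
  by rewrite !big_nil !hornerC conjC1 !mulr1 subrr mulr0.
case/andP=> a1 /IH{}IH; rewrite !big_cons big_map !hornerM !hornerXsubC.
rewrite !horner_refl_factor hornerZ.
rewrite (eq_bigr (fun e => (x - a) * (y - a)^* * (e.[x] * (e.[y])^*)))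
  => [|e _]; last by rewrite !hornerM !hornerXsubC rmorphM mulrACA.
rewrite -mulr_sumr /= !rmorphM /=.
have aa : sqrtC (1 - `|a| ^+ 2) * (sqrtC (1 - `|a| ^+ 2))^* = 1 - a * a^*.
  rewrite -normCK ger0_norm ?sqrtC_ge0 ?sqrtCK ?normCK // subr_ge0 -normCK.
  by rewrite expr_le1 // ltW.
move: IH; rewrite /refl_prod; set D := \prod_(b <- s) refl_factor b.
set B := \prod_(b <- s) ('X - b%:P); set S := \sum_(e <- _) _ => IH.
set r := sqrtC _ in aa *.
transitivity ((1 - x * y^*) * (r * r^*) * (D.[x] * (D.[y])^*)
  + (x - a) * (y^* - a^*) * ((1 - x * y^*) * S)).
  by rewrite aa -IH !rmorphB !rmorphM /= conjC1 conjCK; ring.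
by rewrite hornerZ rmorphM !rmorphB /=; ring.
Qed.

(** Evaluation at the first zero [a] determines the coefficient of the first
    function, the only one that does not vanish at [a]. *)
Lemma takenaka_span zs h : all (fun a => `|a| < 1) zs ->
  (size h <= size zs)%N ->
  exists c : nat -> C, h = \sum_(k < size zs) c k *: (takenaka zs)`_k.
Proof.
elim: zs h => [|a s IH] h /=.
  by rewrite leqn0 size_poly_eq0 => _ /eqP->; exists (fun=> 0); rewrite big_ord0.
case/andP=> a1 hs sh; set r := sqrtC _; set D := refl_prod s.
have r0 : r != 0.
  rewrite sqrtC_eq0 subr_eq0 eq_sym lt_eqF // expr_lt1 //.
have D0 : D.[a] != 0.
  rewrite horner_prod prodf_seq_neq0; apply/allP=> b /(allP hs) b1 /=.
  by rewrite horner_refl_factor disk_mul_neq1 ?norm_conjC // ltW.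
pose k0 := h.[a] / (r * D.[a]).
have /factor_theorem[g gE] : root (h - k0 *: (r *: D)) a.
  by rewrite rootE hornerD hornerN !hornerZ /k0 divfK ?subrr // mulf_neq0.
have sD : (size D <= (size s).+1)%N by exact: size_prod_refl_factor.
have sg : (size g <= size s)%N.
  case: (eqVneq g 0) => [->|g0]; first by rewrite size_poly0.
  rewrite -ltnS; have <- : size (g * ('X - a%:P)) = (size g).+1.
    by rewrite size_Mmonic ?monicXsubC // size_XsubC addn2.
  rewrite -gE (leq_trans (size_polyD _ _)) // geq_max sh size_polyN.
  by do 2!apply: leq_trans (size_scale_leq _ _) _.
have [c gc] := IH g hs sg.
exists (fun k => if k is k'.+1 then c k' else k0).
rewrite big_ord_recl /= -/r -/D -(subrK (k0 *: (r *: D)) h) gE gc addrC.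
congr (_ + _); rewrite mulr_suml; apply: eq_bigr => k _.
by rewrite add0n (nth_map 0) ?size_takenaka // -scalerAl mulrC.
Qed.

(** A Bezout identity for [p] and [q], reduced modulo [q]. *)
Lemma bezout_small p q h a b : coprimep p q -> (size p <= a.+1)%N ->
  size q = b.+1 -> (size h <= a + b)%N ->
  exists u v, [/\ h = u * p + v * q, (size u <= b)%N & (size v <= a)%N].
Proof.
move=> /Bezout_eq1_coprimepP[[u v] /= uv] sp sq sh.
have q0 : q != 0 by rewrite -size_poly_gt0 sq.
pose u' := (h * u) %% q; pose v' := h * v + (h * u) %/ q * p.
have hE : h = u' * p + v' * q.
  rewrite -[LHS]mulr1 -uv /u' /v'.
  have -> : h * (u * p + v * q) = (h * u) * p + h * v * q by ring.
  by rewrite {1}(divp_eq (h * u) q); ring.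
have su : (size u' <= b)%N by rewrite -ltnS -sq ltn_modp.
exists u', v'; split=> //.
case: (eqVneq v' 0) => [->|v0]; first by rewrite size_poly0.
have vq : v' * q = h - u' * p by rewrite {1}hE; ring.
have : (size (v' * q)%R <= a + b)%N.
  rewrite vq (leq_trans (size_polyD _ _)) // geq_max sh size_polyN /=.
  apply: leq_trans (size_polyMleq _ _) _; move: su sp; clear.
  by set x := size _; set y := size _; lia.
rewrite size_mul // sq; set x := size _; clear; lia.
Qed.

Lemma pick_matrix_herm (N : nat) (lam w : 'I_N -> C) i j :
  pick_matrix lam w i j = (pick_matrix lam w j i)^*.
Proof.
rewrite !mxE rmorphM fmorphV /= !rmorphB !rmorphM /= !conjCK conjC1.
by rewrite (mulrC (w j)^*) (mulrC (lam j)^*).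
Qed.

Section Counting.
Variables (N : nat) (lam w : 'I_N -> C) (zs ps : seq C) (c c' : C).
Hypotheses (lam_inj : injective lam) (lam_disk : forall i, `|lam i| < 1).
Hypotheses (zs_disk : all (fun a => `|a| < 1) zs)
  (ps_disk : all (fun a => `|a| < 1) ps).
Hypotheses (c0 : c != 0) (c'0 : c' != 0) (cc' : `|c| = `|c'|).
Let n := c *: blaschke_num zs ps.
Let m := c' *: blaschke_num ps zs.
Hypothesis nm_coprime : coprimep n m.
Let e := (size zs + size ps)%N.
Hypothesis nm_size : (e < size n)%N || (e < size m)%N.
Hypothesis interp : forall i, n.[lam i] = w i * m.[lam i].

Let M i := (blaschke_num ps zs).[lam i].

Let M_neq0 i : M i != 0.
Proof.
apply/eqP => Mi.
have mi : root m (lam i) by rewrite rootZ // rootE -/(M i) Mi.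
have : n.[lam i] != 0 by apply: coprimep_root mi; rewrite coprimep_sym.
by rewrite interp (rootP mi) mulr0 eqxx.
Qed.

Let T (g : {poly C}) s : 'M[C]_(N, size s) :=
  \matrix_(i, k) (g.[lam i] * ((takenaka s)`_k).[lam i] / M i).
Let E := T (refl_prod ps) zs.
Let F := T (refl_prod zs) ps.

Let gram_T g s : all (fun a => `|a| < 1) s -> forall i j,
  (T g s *m (T g s) ^t*) i j
  = g.[lam i] * (g.[lam j])^* / (M i * (M j)^*) / (1 - lam i * (lam j)^*)
    * ((refl_prod s).[lam i] * ((refl_prod s).[lam j])^*
       - (\prod_(a <- s) ('X - a%:P)).[lam i]
         * ((\prod_(a <- s) ('X - a%:P)).[lam j])^*).
Proof.
move=> hs i j; rewrite takenaka_kernel // mulrA divfK; last first.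
  by rewrite disk_mul_neq1 ?norm_conjC // ltW.
rewrite (big_nth 0) big_mkord size_takenaka mulr_sumr !mxE.
apply: eq_bigr => k _; rewrite !mxE !rmorphM fmorphV /= invfM; ring.
Qed.

(** The kernel of [n / m] is a difference of two positive kernels, of ranks
    at most the numbers of zeros and of poles. *)
Lemma pick_matrix_split : pick_matrix lam w = E *m E ^t* - F *m F ^t*.
Proof.
apply/matrixP=> i j; rewrite [RHS]mxE [X in _ + X]mxE !gram_T // mxE.
have wE k : w k = c / c' * ((blaschke_num zs ps).[lam k] / M k).
  have := interp k; rewrite !hornerZ -/(M k) => e1.
  have -> : w k = w k * (c' * M k) / (c' * M k) by rewrite mulfK // mulf_neq0.
  by rewrite -e1; field; rewrite M_neq0 c'0.
have cc : c / c' * (c / c')^* = 1.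
  by rewrite -normCK normrM normfV cc' divff ?normr_eq0 // expr1n.
have lij : 1 - lam i * (lam j)^* != 0.
  by rewrite disk_mul_neq1 ?norm_conjC // ltW.
have Mj : (M j)^* != 0 by rewrite conjC_eq0.
have -> : w i * (w j)^* = (blaschke_num zs ps).[lam i] / M i
    * ((blaschke_num zs ps).[lam j] / M j)^*.
  by rewrite !wE rmorphM mulrACA cc mul1r.
have ME k : M k = (\prod_(a <- ps) ('X - a%:P)).[lam k] * (refl_prod zs).[lam k].
  by rewrite /M hornerM.
rewrite !hornerM -/(refl_prod ps) rmorphM fmorphV /= !rmorphM /=.
set Bzi := (\prod_(a <- zs) _).[lam i].
set Bzj := (\prod_(a <- zs) _).[lam j].
transitivity ((M i * (M j)^* - Bzi * (refl_prod ps).[lam i]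
    * (Bzj^* * ((refl_prod ps).[lam j])^*))
  / (M i * (M j)^*) / (1 - lam i * (lam j)^*)).
  by field; rewrite Mj lij M_neq0.
rewrite [X in (X - _) / _]mulrC {1}ME {1}ME rmorphM /=.
by field; rewrite M_neq0 Mj lij.
Qed.

(** The functional [h |-> sum_i x_i h(lam i) / M i] kills the multiples [h * refl_prod ps]
    and [h * refl_prod zs] with [h] of size at most [size zs], respectively
    [size ps]. These span all the polynomials of size at most [e], among which
    the Lagrange polynomials of the nodes. *)
Lemma split_injective (x : 'rV[C]_N) : (N <= e)%N ->
  x *m E = 0 -> x *m F = 0 -> x = 0.
Proof.
move=> Ne xE xF.
pose L (h : {poly C}) := \sum_i x 0 i / M i * h.[lam i].
have L0 us vs (r : {poly C}) h : all (fun a => `|a| < 1) us ->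
    (forall k, (k < size us)%N -> L (r * (takenaka us)`_k) = 0) ->
    (size h <= size us)%N -> L (h * r) = 0.
  move=> us1 Lr /(takenaka_span us1)[a ->].
  have -> : L ((\sum_(k < size us) a k *: (takenaka us)`_k) * r)
      = \sum_(k < size us) a k * L (r * (takenaka us)`_k).
    rewrite mulr_suml /L; under [RHS]eq_bigr do rewrite mulr_sumr.
    rewrite exchange_big; apply: eq_bigr => i _ /=; rewrite horner_sum mulr_sumr.
    by apply: eq_bigr => k _; rewrite !hornerM hornerZ; ring.
  by rewrite big1 // => k _; rewrite Lr ?mulr0.
have LE h : (size h <= size zs)%N -> L (h * refl_prod ps) = 0.
  apply: L0 => // k kz; move/matrixP: xE => /(_ 0 (Ordinal kz)).
  rewrite !mxE => xE; rewrite -[RHS]xE; apply: eq_bigr => i _.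
  by rewrite !mxE hornerM /=; ring.
have LF h : (size h <= size ps)%N -> L (h * refl_prod zs) = 0.
  apply: L0 => // k kz; move/matrixP: xF => /(_ 0 (Ordinal kz)).
  rewrite !mxE => xF; rewrite -[RHS]xF; apply: eq_bigr => i _.
  by rewrite !mxE hornerM /=; ring.
have LD h1 h2 : L (h1 + h2) = L h1 + L h2.
  by rewrite /L -big_split; apply: eq_bigr => i _; rewrite hornerD mulrDr.
have cop : coprimep (refl_prod zs) (refl_prod ps).
  apply: (coprimep_dvdl (q := n)); first by rewrite dvdpZr // /blaschke_num dvdp_mulIr.
  apply: (coprimep_dvdr (p := m)); first by rewrite dvdpZr // /blaschke_num dvdp_mulIr.
  by rewrite coprimep_sym.
have Lall h : (size h <= e)%N -> L h = 0.
  have sB s t : size (blaschke_num s t) = (size s + size (refl_prod t))%N.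
    rewrite /blaschke_num size_monicM ?monic_prod_XsubC ?size_prod_XsubC //.
    by rewrite prodf_seq_neq0; apply/allP=> b _; apply: refl_factor_neq0.
  have szs : (size (refl_prod zs) <= (size zs).+1)%N by exact: size_prod_refl_factor.
  have sps : (size (refl_prod ps) <= (size ps).+1)%N by exact: size_prod_refl_factor.
  (* The origin is not in both lists, so one of the products has full degree. *)
  move: nm_size; rewrite !size_scale // !sB => /orP[] sz sh.
    have sps' : size (refl_prod ps) = (size ps).+1 by rewrite /e in sz; lia.
    have [u [v [-> su sv]]] := bezout_small cop szs sps' sh.
    by rewrite LD LF ?LE ?addr0.
  have szs' : size (refl_prod zs) = (size zs).+1 by rewrite /e in sz; lia.
  rewrite coprimep_sym in cop; rewrite /e addnC in sh.
  have [u [v [-> su sv]]] := bezout_small cop sps szs' sh.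
  by rewrite LD LF ?LE ?addr0.
apply/matrixP=> k i; rewrite ord1 [RHS]mxE.
pose ell := \prod_(j < N | j != i) ('X - (lam j)%:P).
have sl : (size ell <= e)%N.
  have ell_monic : ell \is monic by exact: monic_prod_XsubC.
  have : size (\prod_(j < N) ('X - (lam j)%:P)) = N.+1.
    rewrite size_prod_XsubC.
    by rewrite -[index_enum _]enumT size_enum_ord.
  rewrite (bigD1 i) //= -/ell size_monicM ?monicXsubC ?monic_neq0 //.
  by rewrite size_XsubC addSn /= add1n => -[->].
have := Lall _ sl; rewrite /L (bigD1 i) //= big1 => [|j ji]; last first.
  by rewrite /ell horner_prod (bigD1 j) //= hornerXsubC subrr mul0r mulr0.
rewrite addr0 => /eqP; rewrite !mulf_eq0 invr_eq0 (negPf (M_neq0 i)) orbF.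
case/orP=> [/eqP //|]; rewrite horner_prod => /eqP l0; exfalso.
have : \prod_(j < N | j != i) ('X - (lam j)%:P).[lam i] != 0.
  apply/prodf_neq0 => j ji; rewrite hornerXsubC subr_eq0.
  by apply: contra ji => /eqP/lam_inj ->.
by rewrite l0 eqxx.
Qed.

(** The first two bounds are Sylvester's law of inertia. When [N <= e] no nonzero
    vector is killed by both [E] and [F], so the law also applies to the larger
    subspaces on which the form is only semidefinite. *)
Lemma eigenvalue_counts (cnt := fun a : pred C =>
    count a (eigenvalues (pick_matrix lam w))) :
  [/\ (cnt (> 0%R) <= size zs)%N, (cnt (< 0%R) <= size ps)%N,
      (N <= e)%N -> (cnt (> 0%R) + cnt (pred1 0%R) <= size zs)%N
    & (N <= e)%N -> (cnt (< 0%R) + cnt (pred1 0%R) <= size ps)%N].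
Proof.
have [U [d [Uu UG]]] := spectral_unitary_diag (pick_matrix_herm lam w).
have Uunit := unitarymx_unit Uu.
have cntE a : cnt a = #|[pred i | a (d 0 i)]|.
  exact: (count_eigenvalues_diag a Uunit UG).
have UGN : U *m - pick_matrix lam w = diag_mx (- d) *m U.
  rewrite mulmxN UG -mulNmx. by rewrite raddfN.
have GE := pick_matrix_split.
have GEN : - pick_matrix lam w = F *m F ^t* - E *m E ^t* by rewrite GE opprB.
have strict (S : pred 'I_N) (y : 'rV[C]_N) :
    (forall i, S i -> d 0 i != 0) -> (forall i, ~~ S i -> y 0 i = 0) ->
    y *m U *m E = 0 -> y *m U *m F = 0 -> y = 0.
  move=> S0 yS yE yF.
  have : y *m diag_mx d *m U = 0.
    by rewrite -mulmxA -UG GE !(mulmxA, mulmxBr) yE yF !mul0mx subrr.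
  move/(congr1 (mulmx^~ (invmx U))); rewrite mulmxK // mul0mx mul_mx_diag.
  move/matrixP=> yd; apply/matrixP=> k i; rewrite ord1 [RHS]mxE.
  case: (boolP (S i)) => [Ti|/yS //]; apply: (mulIf (S0 i Ti)).
  by have := yd 0 i; rewrite !mxE mul0r.
have weak (y : 'rV[C]_N) : (N <= e)%N ->
    y *m U *m E = 0 -> y *m U *m F = 0 -> y = 0.
  move=> Ne yE yF; have := split_injective Ne yE yF.
  by move/(congr1 (mulmx^~ (invmx U))); rewrite mulmxK // mul0mx.
have sum0 (a : pred C) : ~~ a 0 ->
    (cnt a + cnt (pred1 0%R))%N = #|[pred i | a (d 0%R i) || (d 0%R i == 0%R)]|.
  move=> a0; rewrite !cntE -cardUI [X in (_ + X)%N]eq_card0 ?addn0.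
    by apply: eq_card => i; rewrite !inE.
  by move=> i; rewrite !inE; case: eqP => [->|_]; rewrite ?andbF // (negPf a0).
have oppd i : (- d) 0 i = - d 0 i by rewrite mxE.
split.
- rewrite cntE; apply: (inertia_bound Uu UGN GEN) => [i /= di|y yT yF yE].
    by rewrite oppd oppr_le0 ltW.
  by apply: strict yT yE yF => i /= di; rewrite gt_eqF.
- rewrite cntE; apply: (inertia_bound Uu UG GE) => [i /= /ltW //|y yT].
  by apply: strict yT => i /= di; rewrite lt_eqF.
- move=> Ne; rewrite sum0 /= ?ltxx //.
  apply: (inertia_bound Uu UGN GEN) => [i /= di|y _ yF yE]; last exact: weak.
  by rewrite oppd oppr_le0; case/orP: di => [/ltW //|/eqP ->].
- move=> Ne; rewrite sum0 /= ?ltxx //.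
  apply: (inertia_bound Uu UG GE) => [i /= di|y _]; last exact: weak.
  by case/orP: di => [/ltW //|/eqP ->].
Qed.

End Counting.
End TakenakaMalmquist.

(** * Unimodular interpolation *)

Section RationalFunctions.
Variable C : numClosedFieldType.
Implicit Types (phi : {fraction {poly C}}) (p q : {poly C}).
Local Open Scope classical_set_scope.

Lemma cvg_horner (K : numFieldType) (F : set_system K) (FF : Filter F)
    (x : K) (p : {poly K}) : F --> x -> p.[z] @[z --> F] --> p.[x].
Proof.
move=> Fx; elim/poly_ind: p => [|p a IH].
  by rewrite (eq_cvg _ _ (@horner0 K)) horner0; apply: cvg_cst.
rewrite (eq_cvg _ _ (hornerMXaddC p a)) hornerMXaddC.
apply: cvgD; last exact: cvg_cst.
exact: cvgM IH Fx.
Qed.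

Lemma takes_value_rateval phi (x : C) :
  (ratden phi).[x] != 0 -> takes_value phi x (rateval phi x).
Proof.
move=> d0; have xx : x^' --> x by exact: nbhs_dnbhs.
apply: cvgM; first exact: cvg_horner.
by apply: cvgV => //; exact: cvg_horner.
Qed.

Lemma rat_cross_mul p q : q != 0 ->
  let phi := tofrac p / tofrac q in ratnum phi * q = p * ratden phi.
Proof.
move=> q0 phi.
have cross (F : fieldType) (a b a' b' : F) :
    b != 0 -> b' != 0 -> a / b = a' / b' -> a' * b = a * b'.
  by move=> b0 b'0 /eqP; rewrite eqr_div // => /eqP ->.
apply/eqP; rewrite -tofrac_eq !tofracM; apply/eqP.
have d0 : tofrac (ratden phi) != 0 :> {fraction {poly C}}.
  by rewrite tofrac_eq0 ratden_neq0.
have q0' : tofrac q != 0 :> {fraction {poly C}} by rewrite tofrac_eq0.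
have e : tofrac p / tofrac q = tofrac (ratnum phi) / tofrac (ratden phi).
  exact: ratnum_div_ratden.
exact: cross q0' d0 e.
Qed.

(** If [p] and [star d p] have a common factor, it cancels in [n / m], and the
    reflection identity [n star(n) = m star(m)] survives in the lower degree. *)
Lemma lowest_terms_reflection (d : nat) p n m :
  p != 0 -> (size p <= d.+1)%N -> coprimep n m -> m != 0 ->
  n * star d p = p * m ->
  let e := (maxn (size n) (size m)).-1 in
  [/\ n != 0, (e <= d)%N & n * star e n = m * star e m].
Proof.
move=> p0 sp nm m0 npm e.
have q0 : star d p != 0 by rewrite star_eq0.
have n0 : n != 0.
  apply: contraNneq (mulf_neq0 p0 m0) => n0.
  by rewrite -npm n0 mul0r.
have np : (size n <= size p)%N.
  by apply: dvdp_leq => //; rewrite -(Gauss_dvdpl _ nm) -npm dvdp_mulr.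
have mq : (size m <= size (star d p))%N.
  apply: dvdp_leq => //.
  by rewrite -(@Gauss_dvdpr _ _ n) 1?coprimep_sym // npm dvdp_mull.
have n_gt0 : (0 < size n)%N by rewrite size_poly_gt0.
have sn : (size n <= e.+1)%N by rewrite /e; lia.
have sm : (size m <= e.+1)%N by rewrite /e; lia.
have sq := size_star d p.
split=> //; first by rewrite /e; lia.
have : star e n * p = star d p * star e m.
  rewrite -{1}(starK sp) -!starM ?size_star //.
  by rewrite npm addnC.
move=> e2; apply: (mulIf (mulf_neq0 p0 q0)).
have -> : n * star e n * (p * star d p) = n * star d p * (star e n * p) by ring.
by rewrite npm e2; ring.
Qed.

Lemma unimodular_of_reflection phi e :
  (size (ratnum phi) <= e.+1)%N -> (size (ratden phi) <= e.+1)%N ->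
  ratnum phi * star e (ratnum phi) = ratden phi * star e (ratden phi) ->
  unimodular_on_circle phi.
Proof.
set n := ratnum phi; set m := ratden phi => sn sm nnmm x x1.
have xe0 : x ^+ e != 0 by rewrite expf_neq0 // -normr_eq0 x1 oner_neq0.
have nm_x : `|n.[x]| = `|m.[x]|.
  have := congr1 (fun r => r.[x]) nnmm; rewrite !hornerM !horner_star_circle //.
  rewrite !(mulrCA _ (x ^+ e)) => /(mulfI xe0); rewrite -!normCK => /eqP.
  by rewrite eqrXn2 // => /eqP.
have m0 : `|m.[x]| != 0.
  rewrite normr_eq0; apply/negP => mx.
  have nx : root n x by rewrite rootE -normr_eq0 nm_x normr_eq0.
  by move: (coprimep_root (coprimep_ratnum_ratden phi) nx); rewrite -/m mx.
by rewrite /rateval normrM normfV nm_x divff.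
Qed.

(** [a] and [b] stand for zeros and poles, or poles and zeros, and [x] for the
    eigenvalues whose number bounds [a] from below. *)
Lemma complementary_count (N z a b x : nat) : (a + b <= N + z)%N ->
  (x <= a)%N -> ((N <= a + b)%N -> (x + z <= a)%N) -> (b <= N - x)%N.
Proof. by case: (leqP N (a + b)) => ? ? ? => [/(_ isT)|_]; lia. Qed.

Theorem pick_interpolation (N : nat) (lam w : 'I_N -> C)
    (cnt := fun a : pred C => count a (eigenvalues (pick_matrix lam w))) :
  injective lam -> (forall i, `|lam i| < 1) ->
  exists phi, [/\ unimodular_on_circle phi,
    forall i, takes_value phi (lam i) (w i),
    (poles_in_disk phi <= N - cnt (> 0%R))%N
    & (zeros_in_disk phi <= N - cnt (< 0%R))%N].
Proof.
move=> lam_inj lam_disk; set z := cnt (pred1 0).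
have rankG : (N - z <= \rank (pick_matrix lam w))%N.
  have [U [d [Uu UG]]] := spectral_unitary_diag (pick_matrix_herm lam w).
  have Uunit := unitarymx_unit Uu.
  rewrite /z /cnt (count_eigenvalues_diag _ Uunit UG).
  exact: rank_diagonalised Uunit UG.
have [p [p0 [sp p_lam] q_lam]] := exists_self_reflective lam_inj lam_disk rankG.
set d := (N + z)%N in sp p_lam q_lam; set q := star d p in p_lam q_lam.
have q0 : q != 0 by rewrite star_eq0.
pose phi : {fraction {poly C}} := tofrac p / tofrac q; exists phi.
have npm : ratnum phi * q = p * ratden phi by exact: rat_cross_mul.
have nm := coprimep_ratnum_ratden phi; have m0 := ratden_neq0 phi.
have [n0 ed nnmm] := lowest_terms_reflection p0 sp nm m0 npm.
set n := ratnum phi in npm nm n0 ed nnmm *.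
set m := ratden phi in npm nm m0 ed nnmm *.
set e := (maxn (size n) (size m)).-1 in ed nnmm.
have n_gt0 : (0 < size n)%N by rewrite size_poly_gt0.
have sn : (size n <= e.+1)%N by rewrite /e; lia.
have sm : (size m <= e.+1)%N by rewrite /e; lia.
have interp i : n.[lam i] = w i * m.[lam i].
  apply: (mulIf (q_lam i)); rewrite -[LHS]hornerM npm hornerM p_lam /q; ring.
have m_lam i : m.[lam i] != 0.
  apply/negP => mi; have : root m (lam i) by [].
  rewrite coprimep_sym in nm; move/(coprimep_root nm).
  by rewrite interp (eqP mi) mulr0 eqxx.
have [zs [ps [c [c' [hz hp se [c0 c'0 cc'] [nE mE]]]]]] :=
  blaschke_factorization n0 m0 nm nnmm.
have [pos neg pos0 neg0] :
  [/\ (cnt (> 0%R) <= size zs)%N, (cnt (< 0%R) <= size ps)%N,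
      (N <= size zs + size ps)%N -> (cnt (> 0%R) + cnt (pred1 0%R) <= size zs)%N
    & (N <= size zs + size ps)%N -> (cnt (< 0%R) + cnt (pred1 0%R) <= size ps)%N].
  apply: (eigenvalue_counts lam_inj lam_disk hz hp c0 c'0 cc').
  - by rewrite -nE -mE.
  - rewrite -nE -mE se /e; move: n_gt0.
    set a := size n; set b := size m; clear; lia.
  - by move=> i; rewrite -nE -mE.
split.
- exact: unimodular_of_reflection sn sm nnmm.
- move=> i; have -> : w i = rateval phi (lam i).
    by rewrite /rateval -/n -/m interp mulfK.
  exact: takes_value_rateval.
- have -> : poles_in_disk phi = size ps.
    by rewrite -(disk_zeros_blaschke_num c'0 hp hz) -mE.
  by apply: complementary_count pos pos0; rewrite se.
- have -> : zeros_in_disk phi = size zs.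
    by rewrite -(disk_zeros_blaschke_num c0 hz hp) -nE.
  rewrite (addnC (size zs)) in neg0 se.
  by apply: complementary_count neg neg0; rewrite se.
Qed.

End RationalFunctions.

Local Open Scope complex_scope.

Theorem theorem1p7 (R : realType) (N : nat) (lambda w : 'I_N -> R[i])
    (npos nneg nzero : nat)
    (lambda_inj : injective lambda)
    (lambda_disk : forall i : 'I_N, `|lambda i| < 1)
    (npos_def : count (fun a : R[i] => 0 < a)
                  (eigenvalues (pick_matrix lambda w)) = npos)
    (nneg_def : count (fun a : R[i] => a < 0)
                  (eigenvalues (pick_matrix lambda w)) = nneg)
    (nzero_def : count (fun a : R[i] => a == 0)
                   (eigenvalues (pick_matrix lambda w)) = nzero) :
  exists phi : {fraction {poly R[i]}},
    [/\ unimodular_on_circle phi,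
        forall i : 'I_N, takes_value phi (lambda i) (w i),
        (poles_in_disk phi <= N - npos)%N
      & (zeros_in_disk phi <= N - nneg)%N].
Proof.
by rewrite -npos_def -nneg_def; exact: pick_interpolation.
Qed.
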